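(* Let $I$ be a compact interval and $f:I\to I$ a continuous map. (i) $(I,f^2)$ is transitive if and only if $(\mathcal{M}(I),\hat f^2)$ is transitive. (ii) $(I,f)$ is totally transitive if and only if $(\mathcal{M}(I),\hat f)$ is totally transitive.
   Context: For a compact metric space $(X,d)$ and a continuous map $f:X\to X$, $(X,f)$ denotes the corresponding (autonomous) dynamical system. $\mathcal{M}(X)$ is the space of all Borel probability measures on $X$ with the Prohorov metric $\mathcal{P}_d(\mu,\nu)=\inf\{\epsilon>0:\mu(A)\le\nu(A^\epsilon)+\epsilon \text{ and } \nu(A)\le\mu(A^\epsilon)+\epsilon \text{ for all Borel } A\subset X\}$, where $A^\epsilon=\{x\in X: d(x,A)<\epsilon\}$; its topology is the weak$^*$-topology and $\mathcal{M}(X)$ is a compact metric space. The induced continuous map $\hat f:\mathcal{M}(X)\to\mathcal{M}(X)$ is $\hat f(\mu)(A)=\mu(f^{-1}(A))$ for $A$ Borel. A system $(X,f)$ is transitive if for any two nonempty open sets $U,V\subset X$ there is $n\ge1$ with $f^n(U)\cap V\ne\emptyset$. It is totally transitive if $(X,f^n)$ is transitive for every $n\ge1$. Here $f^n$ and $\hat f^n$ denote $n$-fold compositions. *)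

(* Defs.v *)
From HB Require Import structures.
From mathcomp Require Import all_boot all_order all_algebra.
From mathcomp Require Import all_classical all_reals all_analysis.

Set Implicit Arguments.
Unset Strict Implicit.
Unset Printing Implicit Defensive.

Import Order.TTheory GRing.Theory Num.Theory.
Import numFieldNormedType.Exports.

Local Open Scope classical_set_scope.
Local Open Scope ring_scope.

Section transitivity.
Context {T : topologicalType}.
Implicit Type g : T -> T.

Definition topologically_transitive g :=
  forall U V : set T, open U -> open V -> U !=set0 -> V !=set0 ->
  exists n : nat, (1 <= n)%N /\ ((iter n g @` U) `&` V) !=set0.

Definition totally_transitive g :=
  forall n : nat, (1 <= n)%N -> topologically_transitive (iter n g).

End transitivity.

Notation borel X := (g_sigma_algebraType (@open X)).

(* The library's measures are total functions on [set T], unconstrained on the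
   sets that are not measurable. Hence [prohorov] below is a pseudometric on
   [borel_probability X], and its classes of points at distance zero are the
   Borel probability measures in the usual sense: open sets of the pseudometric
   topology are unions of such classes. *)
Definition borel_probability (R : realType) (X : pseudoPMetricType R) : Type :=
  probability (borel X) R.

Section prohorov.
Context {R : realType} {X : pseudoPMetricType R}.
Implicit Types (A : set X) (e : R) (mu nu rho : borel_probability X).

(* [edist_inf A x] is the distance from x to A, equal to +oo when A is empty. *)
Definition thickening A e : set X := [set x | (edist_inf A x < e%:E)%E].

Definition prohorov_bound mu nu : set R := [set e | 0 < e /\
  forall A : set (borel X), measurable A ->
    (mu A <= nu (thickening A e) + e%:E)%E /\
    (nu A <= mu (thickening A e) + e%:E)%E].

Definition prohorov mu nu : R := inf (prohorov_bound mu nu).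

Definition prohorov_ball mu e : set (borel_probability X) :=
  [set nu | prohorov mu nu < e].

Lemma measurable_thickening A e : measurable (thickening A e : set (borel X)).
Proof.
apply: sub_sigma_algebra.
have -> : thickening A e = edist_inf A @^-1` [set y | (y < e%:E)%E] by [].
apply: open_comp; last exact: open_ereal_lt_ereal.
by move=> x _; exact: edist_inf_continuous.
Qed.

Lemma sub_thickening A e : 0 < e -> A `<=` thickening A e.
Proof. by move=> e0 x Ax; rewrite /thickening/= edist_inf0// lte_fin. Qed.

Lemma thickening_thickening A e1 e2 :
  thickening (thickening A e1) e2 `<=` thickening A (e1 + e2).
Proof.
move=> x /ereal_inf_lt[_ [y Ay <-] xy]; rewrite /thickening/=.
apply: (le_lt_trans (edist_inf_triangle A x y)).
by rewrite addrC EFinD; apply: lteD.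
Qed.

Lemma prohorov_bound_has_inf mu nu : has_inf (prohorov_bound mu nu).
Proof.
split; last by exists 0 => e [/ltW].
exists 1; split=> // A mA; split.
- by rewrite (le_trans (probability_le1 mu mA))// leeDr.
- by rewrite (le_trans (probability_le1 nu mA))// leeDr.
Qed.

Lemma prohorov_ball_center mu e : 0 < e -> prohorov_ball mu e mu.
Proof.
move=> e0; have e20 : 0 < e / 2 by rewrite divr_gt0.
apply: (@le_lt_trans _ _ (e / 2)); last first.
  by rewrite ltr_pdivrMr// ltr_pMr// ltr1n.
apply: ge_inf; first by case: (prohorov_bound_has_inf mu mu).
have muA (A : set (borel X)) : measurable A ->
    (mu A <= mu (thickening A (e / 2)) + (e / 2)%:E)%E.
  move=> mA; rewrite (@le_trans _ _ (mu (thickening A (e / 2))))//.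
    apply: le_measure; rewrite ?inE//; first exact: measurable_thickening.
    exact: sub_thickening.
  by rewrite leeDl// lee_fin ltW.
by split=> // A mA; split; exact: muA.
Qed.

Lemma prohorov_boundC mu nu : prohorov_bound mu nu = prohorov_bound nu mu.
Proof.
by apply/seteqP; split=> e [e0 h]; split=> // A /h[].
Qed.

Lemma prohorov_ball_sym mu nu e : prohorov_ball mu e nu -> prohorov_ball nu e mu.
Proof. by rewrite /prohorov_ball/= /prohorov prohorov_boundC. Qed.

Lemma prohorov_ball_triangle mu nu rho e1 e2 :
  prohorov_ball mu e1 nu -> prohorov_ball nu e2 rho ->
  prohorov_ball mu (e1 + e2) rho.
Proof.
move=> /inf_lt - /(_ (prohorov_bound_has_inf _ _).1)[d1 [d10 h1] de1].
move=> /inf_lt - /(_ (prohorov_bound_has_inf _ _).1)[d2 [d20 h2] de2].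
apply: (@le_lt_trans _ _ (d1 + d2)); last exact: ltrD.
apply: ge_inf; first by case: (prohorov_bound_has_inf mu rho).
have step (m1 m2 m3 : borel_probability X) (r1 r2 : R) (A : set (borel X)) :
    (m1 A <= m2 (thickening A r1) + r1%:E)%E ->
    (m2 (thickening A r1) <=
      m3 (thickening (thickening A r1) r2) + r2%:E)%E ->
    (m1 A <= m3 (thickening A (r1 + r2)) + (r1 + r2)%:E)%E.
  move=> h12 h23; apply: (le_trans h12).
  rewrite EFinD [(r1%:E + _)%E]addeC addeA leeD2r// (le_trans h23)// leeD2r//.
  apply: le_measure; rewrite ?inE; try exact: measurable_thickening.
  exact: thickening_thickening.
split; first exact: addr_gt0.
move=> A mA; split.
  exact: step (h1 A mA).1 (h2 _ (measurable_thickening A d1)).1.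
rewrite (addrC d1).
exact: step (h2 A mA).2 (h1 _ (measurable_thickening A d2)).2.
Qed.

End prohorov.

Section borel_probability_pseudometric.
Context {R : realType} {X : pseudoPMetricType R}.

HB.instance Definition _ := Choice.copy (borel_probability X)
  (probability (borel X) R).

HB.instance Definition _ := hasNbhs.Build (borel_probability X)
  (nbhs_ (entourage_ (@prohorov_ball R X))).

HB.instance Definition _ := @Nbhs_isPseudoMetric.Build R (borel_probability X)
  (entourage_ (@prohorov_ball R X)) erefl (@prohorov_ball R X)
  prohorov_ball_center prohorov_ball_sym prohorov_ball_triangle erefl.

End borel_probability_pseudometric.

Lemma continuous_measurable_borel (R : realType) (X Y : pseudoPMetricType R)
  (f : X -> Y) : continuous f -> measurable_fun setT (f : borel X -> borel Y).
Proof.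
move=> cf; apply: (@measurability _ _ (borel X) (borel Y) setT f (@open Y)) => // _ [B oB <-].
by rewrite setTI; apply: sub_sigma_algebra; apply: open_comp => // x _; exact: cf.
Qed.

Section induced.
Context {R : realType} {X : pseudoPMetricType R} (f : X -> X).
Hypothesis cf : continuous f.

(* The argument [cf] only serves to infer the probability structure. *)
Definition borel_pushforward of continuous f :=
  fun mu : borel_probability X => pushforward mu (f : borel X -> borel X).

Section instance.
Variable mu : borel_probability X.

Let mf : measurable_fun setT (f : borel X -> borel X).
Proof. exact: continuous_measurable_borel. Qed.

Let m0 : borel_pushforward cf mu set0 = 0%E.
Proof. by rewrite /borel_pushforward /pushforward preimage_set0 measure0. Qed.

Let m_ge0 A : (0 <= borel_pushforward cf mu A)%E.
Proof. exact: measure_ge0. Qed.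

Let m_sigma_additive : semi_sigma_additive (borel_pushforward cf mu).
Proof.
move=> F mF tF mUF.
have mP (A : set (borel X)) : measurable A -> measurable (f @^-1` A : set (borel X)).
  by move=> mA; rewrite -[X in measurable X]setTI; exact: mf.
rewrite /borel_pushforward /pushforward preimage_bigcup.
apply: measure_semi_sigma_additive.
- by move=> n; exact: mP.
- apply/trivIsetP => /= i j _ _ ij; rewrite -preimage_setI.
  by move/trivIsetP : tF => /(_ _ _ _ _ ij) ->//; rewrite preimage_set0.
- by rewrite -preimage_bigcup; exact: mP.
Qed.

HB.instance Definition _ := isMeasure.Build _ _ _
  (borel_pushforward cf mu) m0 m_ge0 m_sigma_additive.

Let m_setT : borel_pushforward cf mu setT = 1%E.
Proof. by rewrite /borel_pushforward /pushforward preimage_setT probability_setT. Qed.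

HB.instance Definition _ := Measure_isProbability.Build _ _ _
  (borel_pushforward cf mu) m_setT.

End instance.

Definition induced_map (mu : borel_probability X) : borel_probability X :=
  borel_pushforward cf mu : probability (borel X) R.

Lemma induced_mapE (mu : borel_probability X) (A : set (borel X)) :
  induced_map mu A = mu (f @^-1` A).
Proof. by []. Qed.

End induced.

(* The compact interval [a, b] with the topology and the distance inherited
   from R; the proof [ab] makes it nonempty, as the library requires of
   measurable spaces. *)
Definition compact_interval (R : realType) (a b : R) (ab : a <= b) : Type :=
  set_type `[a, b]%classic.

Section compact_interval.
Context {R : realType} {a b : R} (ab : a <= b).

HB.instance Definition _ := PseudoMetric.copy (compact_interval ab)
  (set_type `[a, b]%classic).

Let left_endpoint_subproof : a \in `[a, b]%classic.
Proof. by rewrite inE/= in_itv/= lexx. Qed.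

HB.instance Definition _ := isPointed.Build (compact_interval ab)
  (SigSub left_endpoint_subproof : set_type `[a, b]%classic).

Lemma compact_interval_ballE (x y : compact_interval ab) (e : R) :
  ball x e y = (`|\val x - \val y| < e) :> Prop.
Proof. by []. Qed.

End compact_interval.

(* Main.v *)
(** The heart of the matter is that if f^2 is transitive on a nondegenerate
interval, then f is topologically mixing. There is an interior fixed point c,
and since no proper nondegenerate closed subinterval is invariant under f^2,
one of [a, c] and [c, b] has an image meeting both sides of c; so c
has another preimage c' in the interior. From this, every open interval
eventually covers c, hence eventually covers every interior point. Taking q
near c with f(q) on the same side of c, the times n at which f^n maps the
segment [c, q] over itself form an additive semigroup containing two
consecutive integers, hence all large integers, and mixing follows.

Mixing passes from f to the induced map: cut the interval into finitely many
small Borel cells, choose for each pair (i, j) of cells a point z_ij near cell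
i with f^n(z_ij) near cell j, and push mu x nu forward along the map
(x, y) |-> z_(cell x)(cell y). The result is Prohorov-close to mu and its n-th
image is close to nu, by coupling with the two projections. Conversely,
transitivity is inherited by f from the induced map by looking at
neighbourhoods of point masses. *)
From HB Require Import structures.
Require Import Defs.
From mathcomp Require Import all_boot all_order all_algebra.
From mathcomp Require Import all_classical all_reals all_analysis.
From mathcomp Require Import lra zify.

Set Implicit Arguments.
Unset Strict Implicit.
Unset Printing Implicit Defensive.

Import Order.TTheory GRing.Theory Num.Theory.
Import numFieldNormedType.Exports.

Local Open Scope classical_set_scope.
Local Open Scope ring_scope.

(** * Iterates and arithmetic of times *)

Lemma iter_continuous (T : topologicalType) (g : T -> T) n :
  continuous g -> continuous (iter n g).
Proof.
move=> cg; elim: n => [|n IHn] x /=; first exact: cvg_id.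
by apply: (@continuous_comp _ _ _ (iter n g)); [exact: IHn | exact: cg].
Qed.

(** For positive [n], write [k = q n + r] with [r < n]. From [k >= n^2] follows [q >= n > r], so
    [k = (q - r) n + r (n + 1)]. *)
Lemma additive_eventually (T : set nat) n :
  T 0 -> T n -> T n.+1 -> (forall i j, T i -> T j -> T (i + j)%N) ->
  forall k, (n * n <= k)%N -> T k.
Proof.
move=> T0 Tn Tn1 TD k nk.
have TM i j : T i -> T (j * i)%N.
  by move=> Ti; elim: j => // j; rewrite mulSn; exact: TD.
case: n => [|n] in nk Tn Tn1 *; first by rewrite -[k]muln1; exact: TM.
pose r := (k %% n.+1)%N.
have rs : (r <= k %/ n.+1)%N.
  by rewrite ltnW// (leq_trans (ltn_pmod _ _))// leq_divRL.
have -> : k = ((k %/ n.+1 - r) * n.+1 + r * n.+2)%N.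
  rewrite {1}(divn_eq k n.+1) -/r [(r * _)%N]mulnS addnCA -mulnDl subnK//.
  by rewrite addnC.
by apply: TD; apply: TM.
Qed.

(** Adding between 1 and [m] steps to [i] lands it in the progression [j + m, j + 2m, ...]: the
    difference [i - j] is rounded up to the next strictly larger multiple of [m]. *)
Lemma subn_mod_add m i j : (0 < m)%N -> (j <= i)%N ->
  (m - (i - j) %% m + i = j + ((i - j) %/ m).+1 * m)%N.
Proof.
move=> m0 ji; have := divn_eq (i - j) m; have := ltn_pmod (i - j) m0.
by rewrite mulSn; move: ((i - j) %% m)%N ((i - j) %/ m * m)%N => r q; lia.
Qed.

(** * Interval maps *)

Section interval_maps.
Context {R : realType}.
Implicit Types (F : R -> R) (a b c x y : R).

Lemma is_interval_iter F n (A : set R) : continuous F -> is_interval A ->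
  is_interval (iter n F @` A).
Proof.
move=> cF /connected_intervalP cA; apply/connected_intervalP.
apply: connected_continuous_connected => //.
by apply: continuous_subspaceT; exact: iter_continuous.
Qed.

(** The bounds are imposed on all of the real line, as they hold for [real_extension]. *)
Definition maps_into a b F := forall x, a <= F x <= b.

(** The bound [N] demands arbitrarily late visits; [transitive_large_times] extracts them from plain
    transitivity. *)
Definition square_transitive a b F := forall (u v w z : R) (N : nat),
  a <= u -> u < v -> v <= b -> a <= w -> w < z -> z <= b ->
  exists n x, [/\ (N <= n)%N, u < x < v & w < iter n.*2 F x < z].

Definition interval_mixing a b F := forall u v w z : R,
  a <= u -> u < v -> v <= b -> a <= w -> w < z -> z <= b ->
  exists N, forall n, (N <= n)%N -> exists2 x, u < x < v & w < iter n F x < z.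

(** Orbits of the square that start in [(u, v)] stay in [[u, v]], so they cannot visit [(a, u)] or
    [(v, b)]; transitivity forces both to be empty. *)
Lemma square_invariant_full a b F u v : square_transitive a b F ->
  a <= u -> u < v -> v <= b ->
  (forall x, u <= x <= v -> u <= F (F x) <= v) -> u = a /\ v = b.
Proof.
move=> tF au uv vb inv.
have inv2 n x : u <= x <= v -> u <= iter n.*2 F x <= v.
  by move=> uxv; elim: n => //= n; exact: inv.
split; apply/eqP; rewrite eq_le ?au ?vb ?andbT/= leNgt; apply/negP => h.
- have [n [x [_ /andP[ux xv] /andP[_]]]] :=
    tF u v a u 0 au uv vb (lexx _) h (ltW (lt_le_trans uv vb)).
  by have /andP[+ _] := inv2 n x ltac:(lra) => /le_lt_trans/[apply]; rewrite ltxx.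
- have [n [x [_ /andP[ux xv] /andP[+ _]]]] :=
    tF u v v b 0 au uv vb (ltW (le_lt_trans au uv)) h (lexx _).
  by have /andP[_ +] := inv2 n x ltac:(lra) => /lt_le_trans/[apply]; rewrite ltxx.
Qed.

(** Otherwise [F x - x] keeps one sign on [(a, b)]. With [m] the midpoint, [[a, m]] is then
    invariant if [F m < m], and [[m, b]] if [F m > m]. *)
Lemma interior_fixed_point a b F : a < b -> continuous F -> maps_into a b F ->
  square_transitive a b F -> exists2 c, a < c < b & F c = c.
Proof.
move=> ab cF Fab tF; apply: contrapT => nofix.
have nfix c : a < c < b -> F c != c.
  by move=> acb; apply/eqP => Fc; apply: nofix; exists c.
have root x y : x <= y -> (F x - x) * (F y - y) < 0 ->
    exists2 c, x < c < y & F c = c.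
  move=> xy h.
  have [||c] := @IVT R (fun t => F t - t) x y 0 xy.
  - by apply: continuous_subspaceT => t; apply: cvgB; [exact: cF|exact: cvg_id].
  - by rewrite ge_min le_max; apply/andP; split; nra.
  rewrite in_itv/= => /andP[xc cy] /eqP; rewrite subr_eq0 => /eqP Fc.
  exists c => //; rewrite !lt_neqAle xc cy !andbT.
  apply/andP; split; apply/eqP => e; move: h; first by rewrite e Fc subrr mul0r ltxx.
  by rewrite -e Fc subrr mulr0 ltxx.
pose m := (a + b) / 2; have am : a < m by rewrite /m; lra.
have mb : m < b by rewrite /m; lra.
have := nfix m ltac:(lra); rewrite neq_lt => /orP[Fm|Fm].
- have inv x : a <= x <= m -> a <= F x <= m.
    move=> /andP[ax xm]; have /andP[-> _] /= := Fab x; rewrite leNgt.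
    apply/negP => mFx; have [||c xcm] := root x m => //; first by nra.
    by apply/eqP/nfix; lra.
  have [|_ mb'] := square_invariant_full tF (lexx a) am (ltW mb); last lra.
  by move=> x /inv/inv.
- have inv x : m <= x <= b -> m <= F x <= b.
    move=> /andP[mx xb]; have /andP[_ ->] /= := Fab x; rewrite leNgt andbT.
    apply/negP => mFx; have [||c xcm] := root m x => //; first by nra.
    by apply/eqP/nfix; lra.
  have [|am' _] := square_invariant_full tF (ltW am) mb (lexx b); last lra.
  by move=> x /inv/inv.
Qed.

Lemma IVT_between F x y v : continuous F -> F x < v < F y ->
  exists2 t, (x < t < y) || (y < t < x) & F t = v.
Proof.
move=> cF /andP[xv vy].
have strict t : F t = v -> x != t /\ t != y.
  by move=> Ft; split; apply/eqP => e; move: xv vy; rewrite -Ft ?e -?e ltxx.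
have [xy|/ltW yx] := leP x y.
- have [||t] := @IVT R F x y v xy; first exact: continuous_subspaceT.
    by rewrite ge_min le_max (ltW xv) (ltW vy) !orbT.
  rewrite in_itv/= => /andP[xt ty] Ft; exists t => //.
  by have [nx ny] := strict _ Ft; rewrite !lt_neqAle xt ty nx ny.
- have [||t] := @IVT R F y x v yx; first exact: continuous_subspaceT.
    by rewrite ge_min le_max (ltW xv) (ltW vy) !orbT.
  rewrite in_itv/= => /andP[yt tx] Ft; exists t => //.
  have [nx ny] := strict _ Ft.
  by rewrite !lt_neqAle yt tx (eq_sym y) (eq_sym t x) nx ny orbT.
Qed.

Definition hits F (u v x : R) n := exists2 t, u < t < v & iter n F t = x.

Lemma iter_fixed F c n : F c = c -> iter n F c = c.
Proof. by move=> Fc; elim: n => //= n ->. Qed.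

Lemma is_interval_ooc (u v : R) : is_interval [set t : R | u < t < v].
Proof. by move=> x y /= hx hy z hz; lra. Qed.

Lemma hits_between F u v x y z n : continuous F ->
  hits F u v x n -> hits F u v y n -> x <= z <= y -> hits F u v z n.
Proof.
move=> cF [s us <-] [t ut <-] h.
have [||r ur <-] := @is_interval_iter F n [set t : R | u < t < v] cF
  (@is_interval_ooc u v) (iter n F s) (iter n F t) _ _ z h.
- by exists s.
- by exists t.
- by exists r.
Qed.

(* The intervals F^(n2+km)(u, v), where F^m(u, v) meets (u, v), form a chain.
Their union meets (c', b) and, since F^i is close to c near c for all i <= m,
also (a, c'); so it contains the preimage c' of c. *)
Lemma hits_fixed_point a b c q1 q3 F u v :
  continuous F -> maps_into a b F -> square_transitive a b F ->
  a < c < b -> F c = c -> c <= q1 <= b -> c <= q3 <= b -> F q1 < c < F q3 ->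
  a <= u -> u < v -> v <= b ->
  exists N, forall n, (N <= n)%N -> hits F u v c n.
Proof.
move=> cF Fab tF acb Fc cq1 cq3 Fq au uv vb.
have [c' cc'b Fc'] : exists2 c', c < c' < b & F c' = c.
  have [c' h Fc'] := @IVT_between F q1 q3 c cF Fq.
  by exists c' => //; case/orP: h => h; lra.
(* One step after [c'] the orbit sits at the fixed point [c] and stays there, so a single hit
   suffices. *)
suff [N hN] : exists N, hits F u v c' N.
  exists N.+1 => n Nn; have [t ut Ft] := hN.
  by exists t => //; rewrite -(subnK Nn) iterD /= Ft Fc' (iter_fixed _ Fc).
pose J := [set t : R | u < t < v].
have [n [x0 [n0 Jx0 JFx0]]] := tF u v u v 1%N au uv vb au uv vb.
pose m := n.*2; have m0 : (0 < m)%N by rewrite double_gt0.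
(* [K] is the union of all [F^(km)(J)]; it is connected because [F^m(J)] meets [J] at [F^m(x0)]. *)
pose step A := J `|` (iter m F @` A).
pose K := \bigcup_k iter k step J.
have JU k : J `<=` iter k step J by case: k => // k t Jt; left.
have itvK : is_interval K.
  apply/connected_intervalP/bigcup_connected.
    by exists x0 => k _; exact: JU.
  elim=> [|k IHk] _ /=; first by apply/connected_intervalP; exact: is_interval_ooc.
  apply: connectedU.
  - exists (iter m F x0); split => //; exists x0 => //; exact: JU.
  - by apply/connected_intervalP; exact: is_interval_ooc.
  - by apply/connected_intervalP/is_interval_iter => //; apply/connected_intervalP/IHk.
have KF t k : J t -> K (iter (k * m) F t).
  move=> Jt; exists k => //; elim: k => //= k IHk.
  by rewrite mulSn iterD; right; exists (iter (k * m) F t).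
have hitsK t : K t -> exists k, hits F u v t k.
  case=> k _; elim: k t => [|k IHk] t /=; first by move=> Jt; exists 0, t.
  case=> [Jt|[s /IHk[k' [r Jr <-]] <-]]; first by exists 0, t.
  by exists (m + k')%N, r => //; rewrite iterD.
have [z [cz zb Fz]] : exists z, [/\ c < z, z <= b &
    forall y, c < y < z -> forall i : 'I_m.+1, iter i F y < c'].
  have : \forall y \near c, forall i : 'I_m.+1, iter i F y < c'.
    have := @filter_forall _ _ (fun i : 'I_m.+1 => [set y | iter i F y < c'])
      _ (nbhs_filter c); apply => i.
    have Fic : iter i F c < c' by rewrite iter_fixed//; lra.
    exact: (cvgr_lt _ (@iter_continuous _ F i cF c) _ Fic).
  move=> /nbhs_ballP[e /= e0 He]; exists (Num.min b (c + e)).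
  split; [by rewrite lt_min; lra|by rewrite ge_min lexx|move=> y].
  rewrite lt_min => /and3P[cy yb yce]; apply: He.
  by rewrite /ball/= ltr_distlC; lra.
have [n2 [x2 [_ Jx2 /andP[x2c' _]]]] := tF u v c' b 0 au uv vb ltac:(lra) ltac:(lra) (lexx b).
have [n1 [x1 [n21 Jx1 /Fz x1z]]] := tF u v c z n2 au uv vb ltac:(lra) cz zb.
have itvFK := @is_interval_iter F n2.*2 K cF itvK.
(* The time [2 n1] is delayed by at most [m] steps, to differ from [2 n2] by a multiple of [m]. The
   choice of [z] keeps the delayed point below [c']. *)
pose d := (n1.*2 - n2.*2)%N.
have im : (m - d %% m < m.+1)%N by rewrite ltnS leq_subr.
have := x1z (Ordinal im); rewrite /= -iterD => x1c'.
have x1c'x2 : iter (m - d %% m + n1.*2) F x1 <= c' <= iter n2.*2 F x2.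
  by rewrite (ltW x1c') (ltW x2c').
have [||t Kt Ft] := itvFK _ _ _ _ c' x1c'x2; last first.
- by have [k [r Jr rt]] := hitsK t Kt; exists (n2.*2 + k)%N, r => //; rewrite iterD rt.
- by exists x2 => //; exact: (KF x2 0%N).
have mod_eq : (m - d %% m + n1.*2 = n2.*2 + (d %/ m).+1 * m)%N.
  by apply: subn_mod_add => //; rewrite leq_double.
by rewrite mod_eq iterD; exists (iter ((d %/ m).+1 * m) F x1) => //; exact: KF.
Qed.

(** At all late times the image of [(u, v)] contains [c]; at some late even time it also contains a
    point beyond [x] as seen from [c]. The image is an interval, so it contains [x]. *)
Lemma hits_interior_point a b c q1 q3 F u v x N :
  continuous F -> maps_into a b F -> square_transitive a b F ->
  a < c < b -> F c = c -> c <= q1 <= b -> c <= q3 <= b -> F q1 < c < F q3 ->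
  a <= u -> u < v -> v <= b -> a < x < b ->
  exists2 n, (N <= n)%N & hits F u v x n.
Proof.
move=> cF Fab tF acb Fc cq1 cq3 Fq au uv vb axb.
have [M hM] := hits_fixed_point cF Fab tF acb Fc cq1 cq3 Fq au uv vb.
have hc n : (maxn M N <= n.*2)%N -> hits F u v c n.*2.
  by rewrite geq_max => /andP[/hM].
have [xc|cx] := leP x c.
- have [n [t [Mn ut /andP[_ Ft]]]] := tF u v a x (maxn M N) au uv vb (lexx a) ltac:(lra) ltac:(lra).
  have MN : (maxn M N <= n.*2)%N by rewrite (leq_trans Mn)// -addnn leq_addr.
  exists n.*2; first by rewrite (leq_trans _ MN)// leq_maxr.
  by apply: (hits_between cF _ (hc _ MN)); [by exists t|lra].
- have [n [t [Mn ut /andP[Ft _]]]] := tF u v x b (maxn M N) au uv vb ltac:(lra) ltac:(lra) (lexx b).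
  have MN : (maxn M N <= n.*2)%N by rewrite (leq_trans Mn)// -addnn leq_addr.
  exists n.*2; first by rewrite (leq_trans _ MN)// leq_maxr.
  by apply: (hits_between cF (hc _ MN)); [by exists t|lra].
Qed.

Lemma mixing_of_right_folding a b c q1 q3 F :
  continuous F -> maps_into a b F -> square_transitive a b F ->
  a < c < b -> F c = c -> c <= q1 <= b -> c <= q3 <= b -> F q1 < c < F q3 ->
  interval_mixing a b F.
Proof.
move=> cF Fab tF acb Fc cq1 cq3 Fq u v w z au uv vb aw wz zb.
have hit := hits_interior_point _ cF Fab tF acb Fc cq1 cq3 Fq.
have [q cqb cFq] : exists2 q, c < q < b & c < F q.
  have [q h Fqv] := @IVT_between F c q3 ((c + F q3) / 2) cF ltac:(lra).
  by exists q; [case/orP: h => h|]; lra.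
pose A := [set t | c <= t <= q].
have itvA n : is_interval (iter n F @` A).
  by apply: is_interval_iter => //; rewrite /A => x y /= hx hy t ht; lra.
have Ac n : (iter n F @` A) c by exists c; [rewrite /A/=; lra|exact: iter_fixed].
(* As [F^n([c, q])] is an interval containing [c], [T n] means that it covers [[c, q]]. *)
pose T n := (iter n F @` A) q.
have TA n t : T n -> A t -> (iter n F @` A) t.
  by move=> Tn At; apply: (itvA n c q).
(* A point [t] of [(c, r)] with [F^n(t) = q] gives [T n] because [r <= q], and [T n.+1] because
   [r <= F q] makes [t] the image of a point of [[c, q]]. *)
pose r := Num.min q (F q).
have cr : c < r by rewrite lt_min; lra.
have [rq rF] : r <= q /\ r <= F q by rewrite !ge_min !lexx orbT.
have [n _ [t ct Ft]] := hit c r q 0 ltac:(lra) cr ltac:(lra) ltac:(lra).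
have Tn : T n by exists t => //; rewrite /A/=; lra.
have Tn1 : T n.+1.
  have [s As Fs] : (iter 1 F @` A) t.
    apply: (itvA 1 c (F q)) => //; last by lra.
    by exists q => //; rewrite /A/=; lra.
  by exists s => //; rewrite -addn1 iterD Fs.
have TD i j : T i -> T j -> T (i + j)%N.
  move=> [s As Fs] Tj; have [p Ap Fp] := TA j s Tj As.
  by exists p => //; rewrite iterD Fp.
have Tk := additive_eventually _ Tn Tn1 TD.
have [N1 N1c] := hits_fixed_point cF Fab tF acb Fc cq1 cq3 Fq au uv vb.
(* The time [k] splits in three: [m1] steps spread [(u, v)] over [[c, q]], the middle part, at least
   [n * n] long, keeps [[c, q]] covered, and the last [m2] steps lead from [y] into [(w, z)]. *)
have [m1 N1m1 Hq] := hit u v q N1 au uv vb ltac:(lra).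
have [m2 _ [y cy Fy]] := hit c q ((w + z) / 2) 0 ltac:(lra) ltac:(lra) ltac:(lra) ltac:(lra).
exists (m2 + (n * n + m1))%N => k hk.
have [||s As Fs] := TA (k - m2 - m1)%N y.
- by apply: Tk; [exists q => //; rewrite /A/=; lra|move: hk; clear; lia].
- by rewrite /A/=; lra.
have [p up Fp] := hits_between cF (N1c _ N1m1) Hq As.
exists p => //.
have -> : k = (m2 + ((k - m2 - m1) + m1))%N by move: hk; clear; lia.
by rewrite !iterD Fp Fs Fy; lra.
Qed.

Lemma iter_oppr F n x : iter n (fun t => - F (- t)) x = - iter n F (- x).
Proof. by elim: n => [|n /= ->]; rewrite opprK. Qed.

(** Conjugation by [x |-> -x] reduces to the right-hand case; it swaps the roles of [q1] and
    [q3]. *)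
Lemma mixing_of_left_folding a b c q1 q3 F :
  continuous F -> maps_into a b F -> square_transitive a b F ->
  a < c < b -> F c = c -> a <= q1 <= c -> a <= q3 <= c -> F q1 < c < F q3 ->
  interval_mixing a b F.
Proof.
move=> cF Fab tF acb Fc cq1 cq3 Fq u v w z au uv vb aw wz zb.
pose G t := - F (- t).
have cG : continuous G.
  by move=> t; apply: cvgN; apply: (@continuous_comp _ _ _ -%R F);
    [exact: opp_continuous|exact: cF].
have GE n x : iter n G x = - iter n F (- x) := iter_oppr F n x.
have Gab : maps_into (- b) (- a) G by move=> t; have := Fab (- t); rewrite /G; lra.
have tG : square_transitive (- b) (- a) G.
  move=> u' v' w' z' N h1 h2 h3 h4 h5 h6.
  have [n [x [Nn ux Fx]]] := tF (- v') (- u') (- z') (- w') N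
    ltac:(lra) ltac:(lra) ltac:(lra) ltac:(lra) ltac:(lra) ltac:(lra).
  by exists n, (- x); rewrite GE opprK; split => //; lra.
have mG : interval_mixing (- b) (- a) G.
  by apply: (@mixing_of_right_folding _ _ (- c) (- q3) (- q1)) => //;
    rewrite /G ?opprK ?Fc//; lra.
have [N hN] := mG (- v) (- u) (- z) (- w)
  ltac:(lra) ltac:(lra) ltac:(lra) ltac:(lra) ltac:(lra) ltac:(lra).
exists N => n /hN[x ux]; rewrite GE => Gx.
by exists (- x); lra.
Qed.

Theorem mixing_of_square_transitive a b F : a < b -> continuous F ->
  maps_into a b F -> square_transitive a b F -> interval_mixing a b F.
Proof.
move=> ab cF Fab tF.
have [c acb Fc] := interior_fixed_point ab cF Fab tF.
have /andP[ac cb] := acb.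
have [q1 cq1 Fq1] : exists2 q, c <= q <= b & F q < c.
  apply: contrapT => h.
  have inv q : c <= q <= b -> c <= F q <= b.
    move=> cq; have /andP[_ ->] := Fab q; rewrite andbT leNgt.
    by apply/negP => Fq; apply: h; exists q.
  have [x /inv/inv//|ca _] := square_invariant_full tF (ltW ac) cb (lexx b).
  by rewrite ca ltxx in ac.
have [q2 cq2 Fq2] : exists2 q, a <= q <= c & c < F q.
  apply: contrapT => h.
  have inv q : a <= q <= c -> a <= F q <= c.
    move=> cq; have /andP[-> _] := Fab q; rewrite /= leNgt.
    by apply/negP => Fq; apply: h; exists q.
  have [x /inv/inv//|_ bc] := square_invariant_full tF (lexx a) ac (ltW cb).
  by rewrite bc ltxx in cb.
have [[q3 cq3 Fq3]|h3] := pselect (exists2 q, c <= q <= b & c < F q).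
  by apply: (mixing_of_right_folding cF Fab tF acb Fc cq1 cq3); rewrite Fq1.
have [[q4 cq4 Fq4]|h4] := pselect (exists2 q, a <= q <= c & F q < c).
  by apply: (mixing_of_left_folding cF Fab tF acb Fc cq4 cq2); rewrite Fq4.
(* Here [F] exchanges the two sides of [c], so its square preserves [[c, b]], a contradiction. *)
have [x cx|ca _] := square_invariant_full tF (ltW ac) cb (lexx b); last first.
  by rewrite ca ltxx in ac.
have {}cx : a <= F x <= c.
  have /andP[-> _] := Fab x; rewrite /= leNgt.
  by apply/negP => Fx; apply: h3; exists x.
have /andP[_ ->] := Fab (F x); rewrite andbT leNgt.
by apply/negP => Fx; apply: h4; exists (F x).
Qed.

End interval_maps.

(** * Mixing and transitivity of topological systems *)

Definition topologically_mixing (T : topologicalType) (g : T -> T) :=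
  forall U V : set T, open U -> open V -> U !=set0 -> V !=set0 ->
  \forall n \near \oo, (iter n g @` U) `&` V !=set0.

Lemma mixing_totally_transitive (T : topologicalType) (g : T -> T) :
  topologically_mixing g -> totally_transitive g.
Proof.
move=> mg k k1 U V oU oV U0 V0; have [N _ hN] := mg U V oU oV U0 V0.
exists N.+1; split => //.
have [_ [[x Ux <-] Vx]] := hN (N.+1 * k)%N (leq_trans (leqnSn N) (leq_pmulr _ k1)).
by exists (iter N.+1 (iter k g) x); split; [exists x|rewrite -iterM].
Qed.

(** By induction on [N], a late visit to the preimage of [V] gives a visit to [V] one step later.
    That preimage is nonempty because transitivity supplies a time at least 1. *)
Lemma transitive_large_times (T : topologicalType) (g : T -> T)
    (U V : set T) N :
  continuous g -> topologically_transitive g ->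
  open U -> open V -> U !=set0 -> V !=set0 ->
  exists2 n, (N <= n)%N & exists2 x, U x & V (iter n g x).
Proof.
move=> cg tg oU + U0; elim: N V => [|N IHN] V oV V0.
  have [n [_ [_ [[x Ux <-] Vx]]]] := tg U V oU oV U0 V0.
  by exists n => //; exists x.
have oV' : open (g @^-1` V) by apply: open_comp => // x _; exact: cg.
have V'0 : g @^-1` V !=set0.
  have [n [n1 [_ [[x Ux <-] Vx]]]] := tg U V oU oV U0 V0.
  by exists (iter n.-1 g x); rewrite /preimage/= -iterS prednK.
have [n Nn [x Ux Vx]] := IHN _ oV' V'0.
by exists n.+1 => //; exists x.
Qed.

(** * Prohorov distance and induced maps *)

Section measures.
Context {R : realType} {X : pseudoPMetricType R}.
Implicit Types (mu nu rho : borel_probability X) (f : X -> X).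

Lemma iter_induced_mapE f (cf : continuous f) n mu (A : set (borel X)) :
  measurable A -> iter n (induced_map cf) mu A = mu (iter n f @^-1` A).
Proof.
move=> mA; elim: n A mA => //= n IHn A mA.
rewrite induced_mapE IHn//.
rewrite -[f @^-1` A]setTI.
exact: (@continuous_measurable_borel R X X f cf measurableT _ mA).
Qed.

(** Since [Y] and [Z] are everywhere [e]-close, [Y] in [A] forces [Z] into a thickening of [A], and
    conversely; taking probabilities gives both Prohorov inequalities. *)
Lemma prohorov_ball_coupling d (W : measurableType d) (P : probability W R)
    (Y Z : W -> borel X) mu nu (e e' : R) :
  0 < e -> e < e' -> measurable_fun setT Y -> measurable_fun setT Z ->
  (forall A : set (borel X), measurable A -> mu A = P (Y @^-1` A)) ->
  (forall A : set (borel X), measurable A -> nu A = P (Z @^-1` A)) ->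
  (forall w, ball (Y w : X) e (Z w : X)) ->
  prohorov_ball mu e' nu.
Proof.
move=> e0 ee' mY mZ muE nuE YZ.
(* [e < e1] makes the thickening inequality strict, and [e1 < e'] the bound on the infimum. *)
pose e1 := (e + e') / 2.
have e10 : 0 < e1 by rewrite /e1; lra.
have ee1 : e < e1 by rewrite /e1; lra.
have near_thickening (x y : X) (A : set X) : ball x e y -> A y -> thickening A e1 x.
  move=> xy Ay; rewrite /thickening/=.
  apply: (@le_lt_trans _ _ (edist (x, y))).
    by apply: ereal_inf_lbound; exists y.
  by apply: (@le_lt_trans _ _ e%:E); [exact: edist_fin|rewrite lte_fin].
have pre (G : W -> borel X) (A : set (borel X)) : measurable_fun setT G ->
    measurable A -> measurable (G @^-1` A).
  by move=> mG mA; rewrite -[X in measurable X]setTI; exact: mG.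
apply: (@le_lt_trans _ _ e1); last by rewrite /e1; lra.
apply: ge_inf; first by exists 0 => r [/ltW].
split=> // A mA; have mT := measurable_thickening A e1.
rewrite (muE A)// (nuE A)// (muE _ mT) (nuE _ mT).
have YTZ : Y @^-1` A `<=` Z @^-1` thickening A e1.
  by move=> w /= Aw; apply: near_thickening Aw; exact: ball_sym.
have ZTY : Z @^-1` A `<=` Y @^-1` thickening A e1.
  by move=> w /= Aw; apply: near_thickening Aw.
have leDe1 (x y : \bar R) : (x <= y -> x <= y + e1%:E)%E.
  by move=> /le_trans; apply; rewrite leeDl// lee_fin ltW.
by split; apply: leDe1; apply: le_measure; rewrite ?inE//; exact: pre.
Qed.

Lemma exists_distribution d (W : measurableType d) (P : probability W R)
    (Z : W -> borel X) : measurable_fun setT Z ->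
  exists rho, forall A : set (borel X), rho A = P (Z @^-1` A).
Proof.
move=> mZ.
pose Z' : {mfun W >-> borel X} :=
  HB.pack Z (@isMeasurableFun.Build _ _ _ _ Z mZ).
by exists (distribution P Z' : probability (borel X) R).
Qed.

(** The cells are the fibres of the labelling [c]; some may be empty. *)
Definition finite_borel_partitions := forall e : R, 0 < e ->
  exists (I : finType) (c : borel X -> I),
    (forall i, measurable (c @^-1` [set i])) /\
    forall x y : X, c x = c y -> ball x e y.

Lemma induced_map_mixing f (cf : continuous f) :
  finite_borel_partitions -> topologically_mixing f ->
  topologically_mixing (induced_map cf).
Proof.
move=> part mf U V oU oV [mu Umu] [nu Vnu].
have [e e0 [muU nuV]] : exists2 e, 0 < e &
    prohorov_ball mu e `<=` U /\ prohorov_ball nu e `<=` V.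
  have /nbhs_ballP[e1 /= e10 h1] : nbhs mu U.
    by apply: open_nbhs_nbhs; split.
  have /nbhs_ballP[e2 /= e20 h2] : nbhs nu V.
    by apply: open_nbhs_nbhs; split.
  exists (Num.min e1 e2); first by rewrite lt_min e10.
  split=> rho; rewrite /prohorov_ball/= lt_min => /andP[r1 r2].
    by apply: h1.
  by apply: h2.
(* A point is [e3]-close to the representative of its cell, which is [e3]-close to the chosen point:
   [2 e / 3 < e] in total. *)
pose e3 := e / 3; have e30 : 0 < e3 by rewrite /e3; lra.
have [I [c [mc cball]]] := part e3 e30.
(* For an empty cell this is a default point, which is harmless: only labels [c x] matter in the
   end. *)
pose r i : X := [get x | c x = i].
have rc x : c (r (c x)) = c x.
  by have := @getPex X [set y | c y = c x] (ex_intro _ x erefl).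
have ball_ne (x : X) : (ball x e3)° !=set0 by exists x; exact: nbhsx_ballx.
(* There are finitely many pairs of cells, so one threshold for [n] serves them all. *)
have : \forall n \near \oo, forall p : I * I, exists z,
    ball (r p.1) e3 z /\ ball (r p.2) e3 (iter n f z).
  have := @filter_forall _ _ (fun (p : I * I) => [set n | exists z,
    ball (r p.1) e3 z /\ ball (r p.2) e3 (iter n f z)]) \oo eventually_filter; apply => p.
  have := mf (ball (r p.1) e3)° (ball (r p.2) e3)°
    (open_interior _) (open_interior _) (ball_ne _) (ball_ne _).
  apply: filterS => n [_ [[z /interior_subset rz <-] /interior_subset rfz]].
  by exists z.
apply: filterS => n /choice[z hz].
pose Z (w : borel X * borel X) : borel X := z (c w.1, c w.2).
have mZ : measurable_fun setT Z.
  (* [Z] is constant on products of cells, so the preimage is a finite union of measurable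
     rectangles. *)
  move=> _ A mA; rewrite setTI.
  have -> : Z @^-1` A = \bigcup_(p in [set p | A (z p)])
      ((c @^-1` [set p.1]) `*` (c @^-1` [set p.2])).
    apply/seteqP; split=> [w Aw|w [[i j] /= Az [/= wi wj]]].
      by exists (c w.1, c w.2).
    by rewrite /Z/= wi wj.
  by apply: fin_bigcup_measurable => // p _; exact: measurableX.
pose P : probability (borel X * borel X)%type R :=
  ((mu : probability (borel X) R) \x (nu : probability (borel X) R))%E.
have PE (A B : set (borel X)) : measurable A -> measurable B ->
    P (A `*` B) = (mu A * nu B)%E.
  exact: product_measure1E.
have [muT nuT] : mu [set: borel X] = 1%E /\ nu [set: borel X] = 1%E.
  by split; exact: probability_setT.
have [rho rhoE] := exists_distribution P mZ.
have near_cell x i y : c x = i -> ball (r i) e3 y -> ball (x : X) (e3 + e3) y.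
  by move=> <-; apply: ball_triangle; apply: cball; rewrite rc.
have mfn : measurable_fun setT (iter n f : borel X -> borel X).
  by apply: continuous_measurable_borel; exact: iter_continuous.
have e33 : 0 < e3 + e3 < e by rewrite /e3; lra.
have [e330 e33e] := andP e33.
exists (iter n (induced_map cf) rho); split.
  exists rho => //; apply: muU.
  apply: (@prohorov_ball_coupling _ _ P fst Z mu rho _ _ e330 e33e) => //.
  - move=> A mA; have -> : fst @^-1` A = A `*` [set: borel X].
      by apply/seteqP; split=> [? ?|? []].
    by rewrite PE// nuT mule1.
  - by move=> w; exact: (near_cell _ _ _ erefl (hz (c w.1, c w.2)).1).
apply: nuV.
apply: (@prohorov_ball_coupling _ _ P snd (iter n f \o Z) nu _ _ _ e330 e33e) => //.
- exact: measurableT_comp.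
- move=> A mA; have -> : snd @^-1` A = [set: borel X] `*` A.
    by apply/seteqP; split=> [? ?|? []].
  by rewrite PE// muT mul1e.
- by move=> A mA; rewrite iter_induced_mapE.
- by move=> w; exact: (near_cell _ _ _ erefl (hz (c w.1, c w.2)).2).
Qed.

Definition point_mass (x : X) : borel_probability X :=
  dirac (x : borel X) : probability (borel X) R.

(** The complement of [U] misses the ball of radius [e] about [x], so for [d < e] its [d]-thickening
    misses [x] and has point mass 0. *)
Lemma point_mass_ball (x : X) rho (U : set X) e : open U -> ball x e `<=` U ->
  prohorov_ball (point_mass x) e rho -> (rho (~` U) < e%:E)%E.
Proof.
move=> oU xU /inf_lt - /(_ (prohorov_bound_has_inf _ _).1)[d [d0 hd] de].
have mU : measurable (~` U : set (borel X)).
  by apply: measurableC; exact: sub_sigma_algebra.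
have [_ /le_lt_trans] := hd _ mU; apply.
rewrite /point_mass/= diracE memNset ?add0e ?lte_fin//.
move=> /ereal_inf_lt[_ [y nUy <-]] /edist_lt_ball /= xy.
by apply: nUy; apply: xU; exact: le_ball (ltW de) _ xy.
Qed.

(** A measure near the point mass at [x], with image near the point mass at [y], gives mass below
    [e <= 1/2] both to the complement of [U] and to the points not sent into [V]. These two sets
    cannot cover the space. *)
Lemma transitive_of_induced_map f (cf : continuous f) k :
  topologically_transitive (iter k (induced_map cf)) ->
  topologically_transitive (iter k f).
Proof.
move=> tf U V oU oV [x Ux] [y Vy].
have [e [e0 e2 xU yV]] : exists e, [/\ 0 < e, e <= 1 / 2,
    ball x e `<=` U & ball y e `<=` V].
  have /nbhs_ballP[e1 /= e10 h1] : nbhs x U by apply: open_nbhs_nbhs; split.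
  have /nbhs_ballP[e2 /= e20 h2] : nbhs y V by apply: open_nbhs_nbhs; split.
  exists (Num.min (1 / 2) (Num.min e1 e2)); split.
  - by rewrite !lt_min e10 e20; lra.
  - by rewrite ge_min lexx.
  - by apply: subset_trans h1; apply: le_ball; rewrite !ge_min lexx !orbT.
  - by apply: subset_trans h2; apply: le_ball; rewrite !ge_min lexx !orbT.
have ball_ne (mu : borel_probability X) : (ball mu e)° !=set0.
  by exists mu; exact: nbhsx_ballx.
have [n [n1 [_ [[mu /interior_subset muU <-] /interior_subset muV]]]] :=
  tf _ _ (open_interior _) (open_interior _)
    (ball_ne (point_mass x)) (ball_ne (point_mass y)).
exists n; split => //; apply: contrapT => disj.
have := point_mass_ball oU xU muU; have := point_mass_ball oV yV muV.
have mC (W : set X) : open W -> measurable (~` W : set (borel X)).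
  by move=> oW; apply: measurableC; exact: sub_sigma_algebra.
rewrite -!iterM iter_induced_mapE; last exact: mC.
set V' := _ @^-1` _ => muV' muU'.
have mV' : measurable (V' : set (borel X)).
  rewrite /V' -preimage_setC; apply: mC; apply: open_comp => // t _.
  exact: iter_continuous.
have : (mu setT < e%:E + e%:E)%E.
  apply: le_lt_trans (lteD muU' muV').
  apply: le_trans (measureU2 _ (mC _ oU) mV').
  apply: le_measure; rewrite ?inE//; first by apply: measurableU => //; exact: mC.
  move=> t _; have [Ut|] := pselect (U t); last by left.
  right => Vt; apply: disj; exists (iter n (iter k f) t); split; first by exists t.
  by rewrite -iterM.
have -> : mu setT = 1%E by exact: probability_setT.
by rewrite -EFinD lte_fin; lra.
Qed.

End measures.

Lemma clamp_dist (R : realDomainType) (a b t s : R) :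
  `|Num.max a (Num.min t b) - Num.max a (Num.min s b)| <= `|t - s|.
Proof.
have le_max_dist (x y : R) : `|Num.max a x - Num.max a y| <= `|x - y|.
  rewrite ler_norml.
  by case: (leP a x) => ax; case: (leP a y) => ay; case: (ger0P (x - y)); lra.
apply: le_trans (le_max_dist _ _) _.
rewrite ler_norml.
by case: (leP t b) => tb; case: (leP s b) => sb; case: (ger0P (t - s)); lra.
Qed.

(** * Compact intervals *)

Section compact_interval_maps.
Context {R : realType} {a b : R} {ab : a <= b}.
Local Notation I := (compact_interval ab).
Implicit Types (x y : I) (f : I -> I).

Lemma val_continuous : continuous (val : I -> R).
Proof.
move=> x A /nbhs_ballP[e e0 xA]; apply/nbhs_ballP; exists e => // y.
by rewrite compact_interval_ballE; exact: xA.
Qed.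

Lemma val_bounds x : a <= val x <= b.
Proof. by have := valP x; rewrite inE. Qed.

Lemma open_val_lt (t : R) : open [set x : I | val x < t].
Proof.
by apply: (@open_comp _ _ (val : I -> R) [set s | s < t]);
  [move=> x _; exact: val_continuous|exact: open_lt].
Qed.

Lemma open_val_itv (u v : R) : open [set x : I | u < val x < v].
Proof.
have -> : [set x : I | u < val x < v] = (val : I -> R) @^-1` `]u, v[.
  by apply/seteqP; split=> x; rewrite /preimage/= in_itv.
by apply: open_comp; [move=> x _; exact: val_continuous|exact: itv_open].
Qed.

Lemma compact_interval_partitions : @finite_borel_partitions R I.
Proof.
move=> e e0; pose q x := (val x - a) / e; pose m := Num.trunc ((b - a) / e).
have q0 x : 0 <= q x.
  by have := val_bounds x; rewrite /q => h; apply: divr_ge0; lra.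
have qm x : (Num.trunc (q x) < m.+1)%N.
  rewrite ltnS /m le_truncn// /q ler_pM2r ?invr_gt0//.
  by have := val_bounds x; lra.
exists 'I_m.+1, (fun x : I => Ordinal (qm x)); split=> [i|x y].
  have mlt t : measurable ([set x : I | val x < t] : set (borel I)).
    by apply: sub_sigma_algebra; exact: open_val_lt.
  (* Each cell is a half-open interval of length [e], a difference of two open sets. *)
  have -> : (fun x => Ordinal (qm x)) @^-1` [set i] =
      [set x : I | val x < a + i.+1%:R * e] `\` [set x : I | val x < a + i%:R * e].
    have qlt x n : (q x < n%:R) = (val x < a + n%:R * e).
      by rewrite /q ltr_pdivrMr// ltrBlDl.
    apply/seteqP; split=> [x /= <- /=|x /= [h1 /negP]].
      have /andP[h1 h2] := truncn_itv (q0 x).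
      by rewrite -!qlt; split => //; apply/negP; rewrite -leNgt.
    rewrite -leNgt => h2; apply/val_inj => /=; apply: truncn_def.
    by rewrite qlt h1 andbT leNgt qlt -leNgt.
  exact: measurableD.
move=> [qxy]; rewrite compact_interval_ballE.
have := truncn_itv (q0 x); have := truncn_itv (q0 y); rewrite qxy.
move: (Num.trunc _) => n hx hy.
have : `|q x - q y| < 1 by rewrite ltr_norml -natr1 in hx hy *; lra.
have -> : q x - q y = (val x - val y) / e by rewrite /q -mulrBl; congr (_ / _); lra.
by rewrite normrM normfV (gtr0_norm e0) ltr_pdivrMr// mul1r.
Qed.

Lemma clamp_subproof (t : R) : Num.max a (Num.min t b) \in `[a, b]%classic.
Proof. by rewrite inE/= in_itv/= le_max lexx ge_max ab ge_min lexx orbT. Qed.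

Definition clamp (t : R) : I := SigSub (clamp_subproof t) : set_type `[a, b]%classic.

Lemma val_clamp (t : R) : a <= t <= b -> val (clamp t) = t.
Proof. by move=> /andP[a_t tb] /=; rewrite (min_idPl tb) (max_idPr a_t). Qed.

Lemma clampK x : clamp (val x) = x.
Proof. by apply/val_inj; rewrite val_clamp// val_bounds. Qed.

Lemma clamp_continuous : continuous clamp.
Proof.
move=> t; apply/cvg_ballP => e e0; near=> s.
rewrite compact_interval_ballE /=.
apply: le_lt_trans (clamp_dist _ _ _ _) _.
by near: s; exact: cvgr_dist_lt.
Unshelve. all: by end_near. Qed.

(** This extends [f] to the real line, constantly on each side of [[a, b]], so that the results on
    interval maps apply. *)
Definition real_extension f (t : R) := val (f (clamp t)).

Lemma iter_real_extension f n x : iter n (real_extension f) (val x) = val (iter n f x).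
Proof. by elim: n => //= n ->; rewrite /real_extension clampK. Qed.

Lemma mixing_of_transitive_square f : continuous f ->
  topologically_transitive (iter 2 f) -> topologically_mixing f.
Proof.
move=> cf tf U V oU oV [x0 Ux0] [y0 Vy0].
have [ab'|ba] := ltP a b; last first.
  have all_eq x y : x = y.
    by apply/val_inj; have := val_bounds x; have := val_bounds y; lra.
  near=> n; exists y0; split => //; exists x0 => //; exact: all_eq.
pose F := real_extension f.
have cF : continuous F.
  move=> t; apply: (@continuous_comp _ _ _ clamp (val \o f)).
    exact: clamp_continuous.
  by apply: continuous_comp; [exact: cf|exact: val_continuous].
have Fab : maps_into a b F by move=> t; exact: val_bounds.
have ne u v : a <= u -> u < v -> v <= b -> [set x : I | u < val x < v] !=set0.
  move=> au uv vb; have mid : u < val (clamp ((u + v) / 2)) < v.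
    by rewrite val_clamp; lra.
  by exists (clamp ((u + v) / 2)).
have tF : square_transitive a b F.
  move=> u v w z N au uv vb aw wz zb.
  have [n Nn [x ux wx]] := transitive_large_times N (@iter_continuous _ _ 2 cf) tf
    (open_val_itv u v) (open_val_itv w z) (ne _ _ au uv vb) (ne _ _ aw wz zb).
  exists n, (val x); split => //.
  by rewrite iter_real_extension -muln2 iterM.
have mF := mixing_of_square_transitive ab' cF Fab tF.
(* When [x] is an endpoint, the interval found inside [W] lies on one side of it. *)
have inner (W : set I) x : open W -> W x -> exists u v,
    [/\ a <= u, u < v, v <= b & [set y : I | u < val y < v] `<=` W].
  move=> oW Wx.
  have /nbhs_ballP[e /= e0 he] : nbhs x W by apply: open_nbhs_nbhs; split.
  exists (Num.max a (val x - e)), (Num.min b (val x + e)).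
  have := val_bounds x; split.
  - by rewrite le_max lexx.
  - by rewrite gt_max !lt_min; lra.
  - by rewrite ge_min lexx.
  - move=> y uyv; have : Num.max a (val x - e) < val y < Num.min b (val x + e) := uyv.
    rewrite gt_max lt_min => hy; apply: he.
    by rewrite compact_interval_ballE ltr_norml; lra.
have [u [v [au uv vb uvU]]] := inner U x0 oU Ux0.
have [w [z [aw wz zb wzV]]] := inner V y0 oV Vy0.
have [N hN] := mF u v w z au uv vb aw wz zb.
exists N => // n /hN[t ut Ft].
have tK : val (clamp t) = t by apply: val_clamp; lra.
exists (iter n f (clamp t)); split.
  by exists (clamp t) => //; apply: uvU; move: ut; rewrite -{1 2}tK.
by apply: wzV; rewrite /= -iter_real_extension tK.
Unshelve. all: by end_near. Qed.

End compact_interval_maps.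

Theorem theorem2p4 (R : realType) (a b : R) (ab : a <= b)
    (f : compact_interval ab -> compact_interval ab) (cf : continuous f) :
  (topologically_transitive (iter 2 f) <->
   topologically_transitive (iter 2 (induced_map cf)))
  /\
  (totally_transitive f <-> totally_transitive (induced_map cf)).
Proof.
(* Both forward implications pass through mixing of [f]; total transitivity is used only at the
   exponent 2. *)
have mix : topologically_transitive (iter 2 f) -> totally_transitive (induced_map cf).
  move=> t2; apply: mixing_totally_transitive; apply: induced_map_mixing.
    exact: compact_interval_partitions.
  exact: mixing_of_transitive_square.
split; split=> tf.
- exact: mix.
- exact: transitive_of_induced_map tf.
- by apply: mix; exact: tf.
- by move=> k k1; exact: transitive_of_induced_map (tf k k1).
Qed.
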